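(* Let $X$ and $Y$ be real Hilbert spaces and let $I$ be either $[0,T]$ with $T>0$ or $\mathbb{R}_+=[0,+\infty)$. Assume: (K) $K\subset X$ is a nonempty closed convex cone. (A) $A:X\to X$ satisfies, for some constants $m_A>0$, $L_A>0$: $(Au-Av,u-v)_X\ge m_A\|u-v\|_X^2$ and $\|Au-Av\|_X\le L_A\|u-v\|_X$ for all $u,v\in X$. (R) $\mathcal{R}:C(I;X)\to C(I;Y)$ and for every compact set $\mathcal{J}\subset I$ there exist $l^{\mathcal R}_{\mathcal J}>0$, $L^{\mathcal R}_{\mathcal J}>0$ with $\|\mathcal{R}u_1(t)-\mathcal{R}u_2(t)\|_Y\le l^{\mathcal R}_{\mathcal J}\|u_1(t)-u_2(t)\|_X+L^{\mathcal R}_{\mathcal J}\int_0^t\|u_1(s)-u_2(s)\|_X\,ds$ for all $u_1,u_2\in C(I;X)$, $t\in\mathcal J$. (S) $\mathcal{S}:C(I;X)\to C(I;X)$ and for every compact set $\mathcal{J}\subset I$ there exist $l^{\mathcal S}_{\mathcal J}>0$, $L^{\mathcal S}_{\mathcal J}>0$ with $\|\mathcal{S}u_1(t)-\mathcal{S}u_2(t)\|_X\le l^{\mathcal S}_{\mathcal J}\|u_1(t)-u_2(t)\|_X+L^{\mathcal S}_{\mathcal J}\int_0^t\|u_1(s)-u_2(s)\|_X\,ds$ for all $u_1,u_2\in C(I;X)$, $t\in\mathcal J$. (j) $j:Y\times K\to\mathbb{R}$ is such that (a) for every $\eta\in Y$, $j(\eta,\cdot):K\to\mathbb{R}$ is convex,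 positively homogeneous and Lipschitz continuous; (b) there is $\alpha_j\ge 0$ with $j(\eta_1,v_2)-j(\eta_1,v_1)+j(\eta_2,v_1)-j(\eta_2,v_2)\le\alpha_j\|\eta_1-\eta_2\|_Y\|v_1-v_2\|_X$ for all $\eta_1,\eta_2\in Y$, $v_1,v_2\in K$. (f) $f\in C(I;X)$. Assume moreover that for every compact set $\mathcal J\subset I$, $(\alpha_j+1)(l^{\mathcal R}_{\mathcal J}+l^{\mathcal S}_{\mathcal J})<m_A$. Then there exists a unique function $u:I\to X$ such that $$-u(t)\in \mathrm{N}_{C(\mathcal{R}u(t),t)}\big(Au(t)+\mathcal{S}u(t)\big)\quad\forall\,t\in I,$$ and this solution satisfies $u\in C(I;K)$.
   Context: $C(I;Z)$ denotes the space of continuous functions $I\to Z$, and $\mathcal{R}u(t)$ means $(\mathcal{R}u)(t)$. For a nonempty closed convex set $D\subset X$, the normal cone is $\mathrm{N}_D(x)=\{\xi\in X:(\xi,v-x)_X\le 0\ \forall v\in D\}$ if $x\in D$ and $\mathrm{N}_D(x)=\emptyset$ if $x\notin D$. Given $j$, define $J:Y\times X\to(-\infty,+\infty]$ by $J(\eta,v)=j(\eta,v)$ if $v\in K$ and $J(\eta,v)=+\infty$ if $v\notin K$; set $C(\eta)=\{\xi\in X: J(\eta,v)\ge(\xi,v)_X\ \forall v\in X\}$ (the convex subdifferential of $J(\eta,\cdot)$ at $0_X$) and $C(\eta,t)=f(t)-C(\eta)$ for $\eta\in Y$, $t\in I$. *)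

(* Defs.v *)
From HB Require Import structures.
From mathcomp Require Import all_boot all_order all_algebra.
From mathcomp Require Import all_classical all_reals all_analysis.
Set Implicit Arguments. Unset Strict Implicit. Unset Printing Implicit Defensive.
Import Order.TTheory GRing.Theory Num.Theory.
Import numFieldNormedType.Exports.
Local Open Scope classical_set_scope.
Local Open Scope ring_scope.

(* A real Hilbert space structure on a complete normed space X:
   a symmetric bilinear form whose induced norm is the norm of X. *)
Record inner_product (R : realType) (X : completeNormedModType R) := InnerProduct {
  ip :> X -> X -> R;
  ip_sym : forall u v, ip u v = ip v u;
  ip_linl : forall (a : R) u v w, ip (a *: u + v) w = a * ip u w + ip v w;
  ip_norm : forall u, ip u u = `|u| ^+ 2 }.

Section Defs.
Context (R : realType) (X : completeNormedModType R).

Definition closed_convex_cone (K : set X) :=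
  [/\ K !=set0, closed K,
      (forall (a : R) u v, 0 <= a <= 1 -> K u -> K v -> K (a *: u + (1 - a) *: v))
    & (forall (a : R) u, 0 < a -> K u -> K (a *: u))].

Definition normal_cone (ipX : inner_product X) (D : set X) (x : X) : set X :=
  [set xi | D x /\ forall v, D v -> ipX xi (v - x) <= 0].

Context (Y : completeNormedModType R).

Definition Jfun (K : set X) (j : Y -> X -> R) (eta : Y) (v : X) : \bar R :=
  if `[< K v >] then (j eta v)%:E else +oo%E.

(* C(eta): the convex subdifferential of J(eta, .) at 0 *)
Definition Cset (ipX : inner_product X) (K : set X) (j : Y -> X -> R) (eta : Y)
  : set X := [set xi | forall v, ((ipX xi v)%:E <= Jfun K j eta v)%E].

Definition Cset_t (ipX : inner_product X) (K : set X) (j : Y -> X -> R)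
  (f : R -> X) (eta : Y) (t : R) : set X :=
  [set f t - xi | xi in Cset ipX K j eta].

End Defs.

Definition int0 (R : realType) (g : R -> R) (t : R) : \bar R :=
  (\int[lebesgue_measure]_(s in `[0%R, t]) (g s)%:E)%E.

(* Main.v *)
Require Import Defs.
From HB Require Import structures.
From mathcomp Require Import all_boot all_order all_algebra ring lra.
From mathcomp Require Import all_classical all_reals all_analysis.
From mathcomp Require Import measurable_realfun.
Import Order.TTheory GRing.Theory Num.Theory.
Import numFieldNormedType.Exports.
Local Open Scope classical_set_scope.
Local Open Scope ring_scope.

Set Implicit Arguments.
Unset Strict Implicit.

(** The inclusion is equivalent to the variational inequality
    [(f - A u - S u, v - u) <= j (R u, v) - j (R u, u)] for [v] in [K], with [u] in [K].
    With the values [R u t] and [S u t] frozen, the inequality at time [t] has a unique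
    solution, which depends on them in a Lipschitz way with constants [alphaj / mA] and
    [1 / mA].  Solutions of the problem are thus the fixed points of a history-dependent
    operator with instantaneous constant [(alphaj * lR + lS) / mA < 1].  On each
    [I `&` [0, b]] it is a contraction for an exponentially weighted sup norm, and its
    iterates do not depend on [b], so they converge to the unique fixed point on all of [I]. *)

(** * Inner product identities and the Cauchy-Schwarz inequality *)

Section InnerProduct.
Context (R : realType) (X : completeNormedModType R) (ipX : inner_product X).
Implicit Types (u v w : X) (a : R).

Lemma ipDl u v w : ipX (u + v) w = ipX u w + ipX v w.
Proof. by have := ip_linl ipX 1 u v w; rewrite scale1r mul1r. Qed.

Lemma ip0l w : ipX 0 w = 0.
Proof. by apply: (@addrI _ (ipX 0 w)); rewrite -ipDl !addr0. Qed.

Lemma ipZl a u w : ipX (a *: u) w = a * ipX u w.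
Proof. by have := ip_linl ipX a u 0 w; rewrite addr0 ip0l addr0. Qed.

Lemma ipNl u w : ipX (- u) w = - ipX u w.
Proof. by rewrite -scaleN1r ipZl mulN1r. Qed.

Lemma ipDr u v w : ipX w (u + v) = ipX w u + ipX w v.
Proof. by rewrite !(ip_sym ipX w) ipDl. Qed.

Lemma ipZr a u w : ipX w (a *: u) = a * ipX w u.
Proof. by rewrite !(ip_sym ipX w) ipZl. Qed.

Lemma ipNr u w : ipX w (- u) = - ipX w u.
Proof. by rewrite !(ip_sym ipX w) ipNl. Qed.

Definition ip_bilinE := (ipDl, ipDr, ipNl, ipNr, ipZl, ipZr).

Lemma normrB_sq u v : `|u - v| ^+ 2 = `|u| ^+ 2 - 2 * ipX u v + `|v| ^+ 2.
Proof. by rewrite -!(ip_norm ipX) !ip_bilinE (ip_sym ipX v u); ring. Qed.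

(** Cauchy-Schwarz: expanding the squared norm of |v| u - |u| v gives 2 |u| |v| (|u| |v| - (u, v))
    >= 0. *)
Lemma ip_le u v : ipX u v <= `|u| * `|v|.
Proof.
have [->|u0] := eqVneq u 0; first by rewrite ip0l normr0 mul0r.
have [->|v0] := eqVneq v 0; first by rewrite ip_sym ip0l normr0 mulr0.
have uv0 : 0 < `|u| * `|v| by rewrite mulr_gt0 ?normr_gt0.
have := sqr_ge0 `| `|v| *: u - `|u| *: v |.
rewrite normrB_sq !normrZ !normr_id !ip_bilinE => h.
have : 0 <= 2 * (`|u| * `|v|) * (`|u| * `|v| - ipX u v).
  by apply: (le_trans h); rewrite le_eqVlt; apply/orP; left; apply/eqP; ring.
by rewrite pmulr_rge0 ?subr_ge0// mulr_gt0// ltr0n.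
Qed.

(** The parallelogram identity around [z], with the midpoint written in the shape that the convexity
    of [K] provides. *)
Lemma midpoint_sq u v z :
  `|2^-1 *: u + (1 - 2^-1) *: v - z| ^+ 2 =
  2^-1 * `|u - z| ^+ 2 + 2^-1 * `|v - z| ^+ 2 - 4^-1 * `|u - v| ^+ 2.
Proof.
rewrite -!(ip_norm ipX) !ip_bilinE (ip_sym ipX v u) (ip_sym ipX z u) (ip_sym ipX z v).
by field.
Qed.

End InnerProduct.

(** * Proximal points of convex Lipschitz functionals *)

Section Proximal.
Context (R : realType) (X : completeNormedModType R) (ipX : inner_product X).
Context (K : set X) (phi : X -> R).
Hypothesis K0 : K !=set0.
Hypothesis Kclosed : closed K.
Hypothesis Kconvex :
  forall (a : R) u v, 0 <= a <= 1 -> K u -> K v -> K (a *: u + (1 - a) *: v).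
Hypothesis phi_convex : forall (a : R) v1 v2, 0 <= a <= 1 -> K v1 -> K v2 ->
  phi (a *: v1 + (1 - a) *: v2) <= a * phi v1 + (1 - a) * phi v2.
Hypothesis phi_lip : exists L : R, forall v1 v2, K v1 -> K v2 ->
  `|phi v1 - phi v2| <= L * `|v1 - v2|.

(** Twice the usual proximal functional |v - z|^2 / 2 + phi v. *)
Let Phi (z v : X) : R := `|v - z| ^+ 2 + 2 * phi v.

Let Phi_lbound z : has_lbound [set Phi z v | v in K].
Proof.
have [L hL] := phi_lip; have [v0 Kv0] := K0.
(* By the Lipschitz bound [phi] decreases at most linearly, and s^2 - 2 |L| s >= - |L|^2 absorbs
   this with s = |v - z|. The absolute value is there because [L] may be negative. *)
exists (2 * phi v0 - 2 * `|L| * `|z - v0| - `|L| ^+ 2) => _ [v Kv <-]; rewrite /Phi.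
have h1 : phi v0 - phi v <= `|L| * (`|v - z| + `|z - v0|).
  apply: (le_trans (ler_norm _)); apply: (le_trans (hL _ _ Kv0 Kv)).
  apply: (@le_trans _ _ (`|L| * `|v0 - v|)).
    by rewrite ler_wpM2r ?ler_norm.
  rewrite ler_wpM2l// distrC.
  by rewrite (_ : v - v0 = (v - z) + (z - v0)) ?ler_normD// addrA subrK.
have := sqr_ge0 (`|v - z| - `|L|).
nra.
Qed.

Let Phi_inf z := inf [set Phi z v | v in K].

Let Phi_inf_le z v : K v -> Phi_inf z <= Phi z v.
Proof. by move=> Kv; apply: ge_inf => //; exists v. Qed.

(** Strong convexity: by the parallelogram identity, [Phi] at the midpoint lies below the average by
    at least |u - v|^2 / 4, yet not below the infimum. Near-minimizers are therefore close to each
    other. *)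
Let Phi_gap z u v : K u -> K v ->
  `|u - v| ^+ 2 <= 2 * (Phi z u - Phi_inf z) + 2 * (Phi z v - Phi_inf z).
Proof.
move=> Ku Kv.
have half01 : 0 <= (2^-1 : R) <= 1 by rewrite invr_ge0 ler0n invf_le1 ?ler1n ?ltr0n.
have := Phi_inf_le z (Kconvex half01 Ku Kv).
have := phi_convex half01 Ku Kv.
rewrite /Phi (midpoint_sq ipX). lra.
Qed.

(** The point [p] minimizes [Phi z] over [K]: a minimizing sequence is Cauchy by [Phi_gap]. The
    inequality is the first-order condition at [p] along the segment towards [v]. *)
Lemma prox_exists z :
  exists2 p, K p & forall v, K v -> ipX (z - p) (v - p) <= phi v - phi p.
Proof.
have Hinf : has_inf [set Phi z v | v in K].
  by split=> //; have [v Kv] := K0; exists (Phi z v), v.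
have /choice[u hu] : forall n : nat, exists v, K v /\ Phi z v < Phi_inf z + harmonic n.
  move=> n; have [|_ [v Kv <-] lt] := inf_adherent (eps := harmonic n) _ Hinf.
    by rewrite harmonic_gt0.
  by exists v.
have uK n : K (u n) by have [] := hu n.
have ulim : cvg (u @ \oo).
  apply/cauchy_cvgP/cauchy_exP => e e0.
  (* Two errors below e^2 / 4, each doubled in [Phi_gap], add up to less than e^2. *)
  have : \forall n \near \oo, @harmonic R n < e ^+ 2 / 4.
    have e2 : 0 < e ^+ 2 / 4 by rewrite divr_gt0 ?exprn_gt0.
    have /cvgr0Pnorm_lt/(_ _ e2) := @cvg_harmonic R.
    by apply: filterS => n; apply: le_lt_trans; rewrite ler_norm.
  move=> [N _ hN]; exists (u N), N => // n Nn; rewrite -ball_normE /=.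
  have h1 : harmonic n < e ^+ 2 / 4 := hN n Nn.
  have h2 : harmonic N < e ^+ 2 / 4 := hN N (leqnn N).
  have [_ g1] := hu N; have [_ g2] := hu n.
  rewrite -(@ltr_pXn2r _ 2%N) ?nnegrE//; last exact: ltW.
  apply: (le_lt_trans (Phi_gap z (uK N) (uK n))); lra.
set p := lim (u @ \oo) in ulim.
have Kp : K p by apply: (closed_cvg (F := \oo) (u_ := u) K) => //; apply: nearW.
exists p => //.
have [L hL] := phi_lip.
have phiu : phi (u n) @[n --> \oo] --> phi p.
  apply/cvgrPdist_lt => e e0.
  have d0 : 0 < e / (`|L| + 1) by rewrite divr_gt0// ltr_wpDl.
  have /cvgrPdist_lt/(_ _ d0) := ulim; apply: filterS => n; rewrite ltr_pdivlMr ?ltr_wpDl// => hn.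
  apply: le_lt_trans hn; apply: (le_trans (hL _ _ Kp (uK n))).
  by rewrite mulrC ler_wpM2l// (le_trans (ler_norm _))// lerDl.
have Phiu : Phi z (u n) @[n --> \oo] --> Phi z p.
  rewrite /Phi; apply: cvgD; last by apply: cvgMr.
  apply: (@cvg_comp _ _ _ (fun n => `|u n - z|) (fun x : R => x ^+ 2) _ (nbhs `|p - z|)).
    by apply: cvg_norm; apply: cvgB => //; exact: cvg_cst.
  exact: exprn_continuous.
have Phip : Phi z p <= Phi_inf z.
  have := ler_cvg_to Phiu (cvgD (cvg_cst (Phi_inf z)) (@cvg_harmonic R)); rewrite addr0; apply.
  by apply: nearW => n; apply: ltW; have [] := hu n.
move=> v Kv; rewrite -subr_ge0.
set c := phi v - phi p - ipX (z - p) (v - p).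
(* Minimality of [p] against a v + (1 - a) p, divided by [a]. *)
have hc a : 0 < a -> a <= 1 -> 0 <= 2 * c + a * `|v - p| ^+ 2.
  move=> a0 a1; have a01 : 0 <= a <= 1 by rewrite (ltW a0).
  have := le_trans Phip (Phi_inf_le z (Kconvex a01 Kv Kp)).
  have := phi_convex a01 Kv Kp.
  rewrite /Phi => h1 h2.
  rewrite -(pmulr_rge0 _ a0).
  have e1 : `|a *: v + (1 - a) *: p - z| ^+ 2 = `|p - z| ^+ 2 - 2 * a * ipX (z - p) (v - p) + a ^+ 2 * `|v - p| ^+ 2.
    rewrite -!(ip_norm ipX) !ip_bilinE (ip_sym ipX p v) (ip_sym ipX z v) (ip_sym ipX z p).
    by ring.
  rewrite e1 in h2; rewrite /c; nra.
rewrite leNgt; apply/negP => c0.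
have d0 := sqr_ge0 `|v - p|.
set d := `|v - p| ^+ 2 in hc d0.
(* If c < 0, this value of [a] gives a d <= - c, hence 2 c + a d <= c < 0. The 1 added to [d] keeps
   the quotient defined when v = p. *)
have := hc (Num.min 1 (- c / (d + 1))).
rewrite lt_min ltr01 divr_gt0 ?oppr_gt0 ?ltr_wpDl// ge_min lexx => /(_ isT isT).
have : Num.min 1 (- c / (d + 1)) * d <= - c.
  apply: (@le_trans _ _ (- c / (d + 1) * d)).
    by rewrite ler_wpM2r// ge_min lexx orbT.
  rewrite -mulrA ler_piMr ?oppr_ge0 ?ltW// mulrC ltr_pdivrMr ?ltr_wpDl// mul1r ltrDl//.
lra.
Qed.

End Proximal.

(** * Elliptic variational inequalities: stability and existence *)

Definition vi_solution (R : realType) (X : completeNormedModType R)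
    (ipX : inner_product X) (K : set X) (phi : X -> R) (B : X -> X) (g u : X) :=
  K u /\ forall v, K v -> ipX (g - B u) (v - u) <= phi v - phi u.

Section VariationalInequality.
Context (R : realType) (X : completeNormedModType R) (ipX : inner_product X).
Context (K : set X).
Implicit Types (phi : X -> R) (B : X -> X).

(** Each inequality is tested with the other solution and the two are added; strong monotonicity and
    Cauchy-Schwarz then leave a common factor |u1 - u2| to cancel. *)
Lemma vi_stability phi1 phi2 B (m c : R) g1 g2 u1 u2 :
  (forall u v, m * `|u - v| ^+ 2 <= ipX (B u - B v) (u - v)) ->
  vi_solution ipX K phi1 B g1 u1 -> vi_solution ipX K phi2 B g2 u2 ->
  phi1 u2 - phi1 u1 + phi2 u1 - phi2 u2 <= c * `|u1 - u2| ->
  0 <= c ->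
  m * `|u1 - u2| <= `|g1 - g2| + c.
Proof.
move=> monoB [Ku1 vi1] [Ku2 vi2] hc c0.
have [->|n0] := eqVneq `|u1 - u2| 0; first by rewrite mulr0 addr_ge0.
have {}n0 : 0 < `|u1 - u2| by rewrite lt_neqAle eq_sym n0 normr_ge0.
rewrite -(ler_pM2r n0) -mulrA -expr2.
have := monoB u1 u2; have := vi1 _ Ku2; have := vi2 _ Ku1.
have := ip_le ipX (g1 - g2) (u1 - u2).
rewrite !ip_bilinE; nra.
Qed.

Hypothesis K0 : K !=set0.
Hypothesis Kclosed : closed K.
Hypothesis Kconvex :
  forall (a : R) u v, 0 <= a <= 1 -> K u -> K v -> K (a *: u + (1 - a) *: v).

(* Banach's theorem for [u |-> prox_(r phi) (u - r (B u - g))] with [r = m / M ^ 2];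
   any [M > m] that is a Lipschitz constant of [B] makes it a contraction. *)
Lemma vi_exists phi B (m L : R) g :
  (forall (a : R) v1 v2, 0 <= a <= 1 -> K v1 -> K v2 ->
     phi (a *: v1 + (1 - a) *: v2) <= a * phi v1 + (1 - a) * phi v2) ->
  (exists L : R, forall v1 v2, K v1 -> K v2 ->
     `|phi v1 - phi v2| <= L * `|v1 - v2|) ->
  0 < m -> 0 < L ->
  (forall u v, m * `|u - v| ^+ 2 <= ipX (B u - B v) (u - v)) ->
  (forall u v, `|B u - B v| <= L * `|u - v|) ->
  exists u, vi_solution ipX K phi B g u.
Proof.
move=> cvx [Lp lip] m0 L0 monoB lipB.
pose M := L + m; pose r := m / M ^+ 2.
have M0 : 0 < M by rewrite addr_gt0.
have r0 : 0 < r by rewrite divr_gt0// exprn_gt0.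
pose rphi v := r * phi v.
(* With the identity as operator, [vi_solution] characterizes the proximal point. *)
have /choice[prox hprox] : forall z, exists p, vi_solution ipX K rphi id z p.
  move=> z; have [| |p Kp hp] := @prox_exists R X ipX K rphi K0 Kclosed Kconvex _ _ z.
  - move=> a v1 v2 a01 K1 K2; have := cvx _ _ _ a01 K1 K2; rewrite /rphi.
    rewrite -(ler_pM2l r0) => /le_trans; apply.
    by rewrite le_eqVlt; apply/orP; left; apply/eqP; ring.
  - exists (r * Lp) => v1 v2 K1 K2; rewrite /rphi -mulrBr normrM (gtr0_norm r0) -mulrA.
    by rewrite ler_pM2l// lip.
  - by exists p.
pose F u := prox (u - r *: (B u - g)).
have proxK z : K (prox z) by have [] := hprox z.
(* Nonexpansiveness is stability with modulus 1 and an unchanged functional. *)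
have prox1 z1 z2 : `|prox z1 - prox z2| <= `|z1 - z2|.
  have := @vi_stability rphi rphi id 1 0 z1 z2 _ _ _ (hprox z1) (hprox z2) _ (lexx 0).
  rewrite mul1r addr0; apply.
    by move=> u v; rewrite mul1r ip_norm.
  by rewrite mul0r; lra.
(* The squared contraction factor: 1 - 2 r m + r^2 M^2 at r = m / M^2. *)
pose k2 := 1 - m ^+ 2 / M ^+ 2.
have k2_lt1 : k2 < 1 by rewrite ltrBlDr ltrDl divr_gt0// exprn_gt0.
have k2_ge0 : 0 <= k2.
  rewrite subr_ge0 ler_pdivrMr ?exprn_gt0// mul1r lerXn2r ?nnegrE ?ltW//.
  by rewrite /M ltrDr.
have contr u v : `|F u - F v| <= Num.sqrt k2 * `|u - v|.
  apply: (le_trans (prox1 _ _)).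
  rewrite -(@ler_pXn2r _ 2%N) ?nnegrE ?mulr_ge0 ?sqrtr_ge0//.
  rewrite exprMn sqr_sqrtr//.
  have -> : u - r *: (B u - g) - (v - r *: (B v - g)) = (u - v) - r *: (B u - B v).
    rewrite opprD opprK addrACA; congr (_ + _).
    by rewrite addrC -opprB -scalerBr; congr (- (_ *: _)); rewrite opprB addrA subrK.
  rewrite (normrB_sq ipX) normrZ ipZr (ip_sym ipX (u - v)) (gtr0_norm r0).
  have h1 := monoB u v.
  have h2 : `|B u - B v| ^+ 2 <= M ^+ 2 * `|u - v| ^+ 2.
    rewrite -exprMn lerXn2r ?nnegrE ?mulr_ge0// ?(ltW M0)//.
    by apply: (le_trans (lipB _ _)); rewrite ler_wpM2r// /M lerDl ltW.
  have rM : r * M ^+ 2 = m by rewrite /r divfK// gt_eqF// exprn_gt0.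
  have k2E : k2 = 1 - r * m by rewrite /k2 /r; field; rewrite gt_eqF.
  rewrite k2E exprMn.
  have h1' : 2 * r * (m * `|u - v| ^+ 2) <= 2 * r * ipX (B u - B v) (u - v).
    by rewrite ler_wpM2l// mulr_ge0 ?ltW.
  have h2' : r ^+ 2 * `|B u - B v| ^+ 2 <= r * m * `|u - v| ^+ 2.
    apply: (@le_trans _ _ (r ^+ 2 * (M ^+ 2 * `|u - v| ^+ 2))).
      by rewrite ler_wpM2l// sqr_ge0.
    by rewrite -[in leRHS]rM le_eqVlt; apply/orP; left; apply/eqP; ring.
  lra.
have Ffun : set_fun [set: X] [set: X] F by [].
pose FF : {fun [set: X] >-> [set: X]} := HB.pack F (isFun.Build _ _ _ _ F Ffun).
have [|//||p _ pE] := @banach_fixed_point R X setT FF.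
- exists (NngNum (sqrtr_ge0 k2)); split => /=.
    by rewrite -(@ltr_pXn2r _ 2%N) ?nnegrE ?sqrtr_ge0// sqr_sqrtr// expr1n.
  by move=> [u v] _ /=; exact: contr.
- by exists 0.
have {}pE : p = prox (p - r *: (B p - g)) by [].
have [_ hp] := hprox (p - r *: (B p - g)).
(* At the fixed point, the proximal inequality is [r] times the required one. *)
exists p; split; first by rewrite pE.
move=> v Kv; have := hp v Kv; rewrite -pE /= /rphi -mulrBr.
by rewrite (addrC p) addrK -scalerN opprB ipZl ler_pM2l.
Qed.

End VariationalInequality.

(** * From the normal cone inclusion to a variational inequality *)

Section NormalConeVI.
Context (R : realType) (X Y : completeNormedModType R) (ipX : inner_product X).
Context (K : set X) (j : Y -> X -> R) (eta : Y).
Hypothesis Kccc : closed_convex_cone K.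
Hypothesis j_convex : forall (a : R) v1 v2, 0 <= a <= 1 -> K v1 -> K v2 ->
  j eta (a *: v1 + (1 - a) *: v2) <= a * j eta v1 + (1 - a) * j eta v2.
Hypothesis j_hom : forall (a : R) v, 0 < a -> K v -> j eta (a *: v) = a * j eta v.
Hypothesis j_lip : exists L : R, forall v1 v2, K v1 -> K v2 ->
  `|j eta v1 - j eta v2| <= L * `|v1 - v2|.

Lemma CsetP xi : Cset ipX K j eta xi <-> forall v, K v -> ipX xi v <= j eta v.
Proof.
rewrite /Cset /Jfun /=; split=> h v.
  by move=> Kv; have := h v; case: asboolP => // _; rewrite lee_fin.
by case: asboolP => [/h|_]; rewrite ?lee_fin// leey.
Qed.

(** Testing with 2 u and u / 2 forces (xi, u) = j u by positive homogeneity; subtracting this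
    equality leaves the inequality defining [Cset]. *)
Lemma vi_coneP u xi : K u ->
  (forall v, K v -> ipX xi (v - u) <= j eta v - j eta u) <->
  Cset ipX K j eta xi /\ ipX xi u = j eta u.
Proof.
have [_ _ _ Kcone] := Kccc.
move=> Ku; split=> [h|[/CsetP h e] v Kv]; last first.
  by rewrite !ip_bilinE e lerB// h.
have e : ipX xi u = j eta u.
  have h20 : 0 < 2^-1 :> R by rewrite invr_gt0 ltr0n.
  have := h _ (Kcone _ _ (ltr0Sn R 1) Ku); have := h _ (Kcone _ _ h20 Ku).
  rewrite !j_hom// ?ltr0n// !ip_bilinE => h1 h2; lra.
split=> //; apply/CsetP => v Kv.
by have := h v Kv; rewrite !ip_bilinE e lerD2r.
Qed.

(* For the direct implication, the maximality of [xi] over [Cset] against [u], tested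
   with the residual of the proximal point [p] of [xi + u] (Moreau's decomposition),
   forces [u = p]. *)
Lemma normal_cone_viP (B : X -> X) (f : R -> X) (t : R) (w u : X) :
  normal_cone ipX (Cset_t ipX K j f eta t) (B u + w) (- u) <->
  vi_solution ipX K (j eta) B (f t - w) u.
Proof.
have [K0 Kclosed Kconvex _] := Kccc.
have xiE : f t - (B u + w) = f t - w - B u by rewrite opprD addrA addrAC.
have bE xi : f t - xi = B u + w -> xi = f t - w - B u.
  by move=> h; rewrite -xiE -h opprB addrC subrK.
rewrite /normal_cone /Cset_t /vi_solution /=; split; last first.
  move=> [Ku /(vi_coneP _ Ku)[Cxi e]]; split.
    by exists (f t - w - B u) => //; rewrite -xiE opprB addrC subrK.
  move=> _ [xi' /CsetP Cxi' <-].
  have -> : f t - xi' - (B u + w) = (f t - w - B u) - xi' by rewrite -xiE addrAC.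
  by rewrite !ip_bilinE !(ip_sym ipX u); have := Cxi' _ Ku; rewrite !ip_bilinE in e *; lra.
move=> [[xi Cxi /bE xiE'] hmax]; rewrite -xiE' in xiE *.
have [p Kp hp] := prox_exists ipX K0 Kclosed Kconvex j_convex j_lip (xi + u).
have /(vi_coneP _ Kp)[Cq qE] := hp.
have /CsetP/(_ _ Kp) h1 := Cxi.
have h2 : ipX (- u) (xi - (xi + u - p)) <= 0.
  have <- : f t - (xi + u - p) - (B u + w) = xi - (xi + u - p) by rewrite -xiE addrAC.
  by apply: hmax; exists (xi + u - p).
(* [h2] says |u|^2 <= (u, p), while [h1] and [qE] give |p|^2 <= (u, p); together they yield |u -
   p|^2 <= 0. *)
have up : u = p.
  apply/eqP; rewrite -subr_eq0 -normr_eq0 -sqrf_eq0 eq_le sqr_ge0 andbT.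
  rewrite -(ip_norm ipX); move: h1 h2 qE.
  rewrite !ip_bilinE (ip_sym ipX u xi) (ip_sym ipX p u); lra.
rewrite {1}up; split=> // v Kv; have := hp v Kv; rewrite -up.
by rewrite (_ : xi + u - u = xi) ?addrK.
Qed.

End NormalConeVI.

(** * Fixed points of history-dependent operators *)

Section HistoryDependent.
Context (R : realType).

(** The antiderivative is explicit and its value at 0 is dropped. The factor 1 / beta gained here
    makes the history term small for large [beta]. *)
Lemma int0_expR_le (c beta t : R) : 0 <= c -> 0 < beta -> 0 <= t ->
  (int0 (fun s => c * expR (beta * s))%R t <= (c / beta * expR (beta * t))%:E)%E.
Proof.
move=> c0 b0; rewrite le_eqVlt => /predU1P[<-|t0]; rewrite /int0.
  by rewrite set_itv1 integral_set1 lee_fin mulr_ge0 ?divr_ge0 ?expR_ge0// ltW.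
pose F s := c / beta * expR (beta * s).
have dF (s : R) : is_derive s (1 : R) F (c * expR (beta * s)).
  rewrite /F; apply: is_derive_eq; rewrite /GRing.scale /= !(mulr1, mulr0, addr0, add0r).
  by field; rewrite gt_eqF.
have cF : continuous F.
  by move=> s; apply/differentiable_continuous/derivable1_diffP; have [] := dF s.
have cG : continuous (fun s => c * expR (beta * s)).
  move=> s; apply: cvgMr; apply: (@continuous_comp _ _ _ ( *%R beta) expR).
    exact: mulrl_continuous.
  exact: continuous_expR.
rewrite (@continuous_FTC2 R (fun s => c * expR (beta * s)) F 0 t)//.
- by rewrite -EFinB lee_fin lerBlDr lerDl mulr_ge0 ?divr_ge0 ?expR_ge0// ltW.
- exact: continuous_subspaceT.
- split.
  + by move=> s _; have [] := dF s.
  + by apply: cvg_at_right_filter; exact: cF.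
  + by apply: cvg_at_left_filter; exact: cF.
- by move=> s _; rewrite derive1E; have [] := dF s.
Qed.

Lemma int0_le_expR (g : R -> R) (c beta t : R) :
  {within `[0, t], continuous g} -> (forall s, 0 <= g s) ->
  0 <= c -> 0 < beta -> 0 <= t ->
  (forall s, 0 <= s <= t -> g s <= c * expR (beta * s)) ->
  (int0 g t <= (c / beta * expR (beta * t))%:E)%E.
Proof.
move=> cg g0 c0 b0 t0 h; apply: le_trans (int0_expR_le c0 b0 t0).
apply: ge0_le_integral => //.
- by move=> s _; rewrite lee_fin.
- by apply/measurable_EFinP; apply: subspace_continuous_measurable_fun.
- apply/measurable_EFinP; apply: subspace_continuous_measurable_fun; first exact: measurable_itv.
  apply: continuous_subspaceT => s; apply: cvgMr.
  apply: (@continuous_comp _ _ _ ( *%R beta) expR); first exact: mulrl_continuous.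
  exact: continuous_expR.
Qed.

Lemma geometric_lt (r D e : R) : 0 <= r < 1 -> 0 < e -> exists n, r ^+ n * D < e.
Proof.
move=> /andP[r0 r1] e0.
have d0 : 0 < e / (`|D| + 1) by rewrite divr_gt0// ltr_wpDl.
have rn : `|r| < 1 by rewrite ger0_norm.
have /cvgr0Pnorm_lt/(_ _ d0)[N _ /(_ N (leqnn N))] := cvg_expr rn.
rewrite /= ger0_norm ?exprn_ge0// ltr_pdivlMr ?ltr_wpDl// => h.
exists N; apply: le_lt_trans h; rewrite ler_wpM2l ?exprn_ge0//.
by rewrite (le_trans (ler_norm _))// lerDl.
Qed.

Lemma geometric_le0 (r D x : R) : 0 <= r < 1 -> (forall n, x <= r ^+ n * D) -> x <= 0.
Proof.
move=> r01 h; rewrite leNgt; apply/negP => x0.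
by have [n /(le_lt_trans (h n))] := geometric_lt D r01 x0; rewrite ltxx.
Qed.

Context (X : completeNormedModType R) (I : set R).
(** These properties are shared by [0, T] and R_+, so that both cases are treated at once. *)
Hypothesis I_closed : closed I.
Hypothesis I_ge0 : forall t, I t -> 0 <= t.
Hypothesis I_down : forall s t, I t -> 0 <= s <= t -> I s.

Let trunc_compact (b : R) : compact (I `&` `[0, b]).
Proof. by rewrite setIC; apply: compact_closedI => //; exact: segment_compact. Qed.

Lemma within_continuous_normB (u v : R -> X) (D : set R) :
  {within D, continuous u} -> {within D, continuous v} ->
  {within D, continuous (fun s => `|u s - v s|)}.
Proof.
move=> /subspace_continuousP cu /subspace_continuousP cv.
apply/subspace_continuousP => x Dx; apply: cvg_norm; apply: cvgB; [exact: cu|exact: cv].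
Qed.

Lemma within_continuous_bounded (u v : R -> X) (b : R) :
  {within I, continuous u} -> {within I, continuous v} ->
  exists2 c, 0 <= c & forall t, I t -> t <= b -> `|u t - v t| <= c.
Proof.
move=> cu cv.
have sub : I `&` `[0, b] `<=` I by move=> ? [].
have c := within_continuous_normB (continuous_subspaceW sub cu) (continuous_subspaceW sub cv).
have [M [_ /(_ (`|M| + 1))]] := compact_bounded (continuous_compact c (@trunc_compact b)).
rewrite (le_lt_trans (ler_norm M)) ?ltrDl// => /(_ isT) h.
exists (`|M| + 1) => [|t It tb]; first by rewrite addr_ge0.
have := h `|u t - v t|; rewrite /= normr_id; apply.
by exists t => //; split=> //=; rewrite in_itv/= tb I_ge0.
Qed.

Variable Lam : (R -> X) -> R -> X.
Hypothesis Lam_cont :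
  forall u, {within I, continuous u} -> {within I, continuous (Lam u)}.
Hypothesis Lam_hist : forall b : R, exists q L : R, [/\ 0 <= q < 1, 0 <= L &
  forall u1 u2, {within I, continuous u1} -> {within I, continuous u2} ->
  forall t, I t -> t <= b ->
    (`|Lam u1 t - Lam u2 t|%:E <= (q * `|u1 t - u2 t|)%:E +
       L%:E * int0 (fun s => `|u1 s - u2 s|)%R t)%E].

(* [r] is a contraction factor of [Lam] for the Bielecki distance
   [sup_(t <= b) |u1 t - u2 t| / expR (beta * t)]. *)
Definition bielecki_contracting (b r beta : R) :=
  forall u1 u2 (c : R), {within I, continuous u1} -> {within I, continuous u2} ->
  0 <= c ->
  (forall t, I t -> t <= b -> `|u1 t - u2 t| <= c * expR (beta * t)) ->
  forall t, I t -> t <= b -> `|Lam u1 t - Lam u2 t| <= r * c * expR (beta * t).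

(* Any [beta] with [q + L / beta < 1] works. *)
Lemma bielecki_contraction (b : R) :
  exists r beta : R, [/\ 0 <= r < 1, 0 < beta & bielecki_contracting b r beta].
Proof.
have [q [L [/andP[q0 q1] L0 hL]]] := Lam_hist b.
have q1' : 0 < 1 - q by rewrite subr_gt0.
(* Then (1 - q) beta = L + 1 exceeds [L]; the 1 keeps [beta] positive when L = 0. *)
pose beta := (L + 1) / (1 - q).
have b0 : 0 < beta by rewrite divr_gt0// ltr_wpDl.
exists (q + L / beta), beta; split=> //.
  apply/andP; split; first by rewrite addr_ge0// divr_ge0// ltW.
  rewrite -ltrBrDl ltr_pdivrMr// /beta.
  by rewrite mulrCA divff ?gt_eqF// mulr1 ltrDl.
move=> u1 u2 c c1 c2 c0 h t It tb; rewrite -lee_fin.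
apply: (le_trans (hL _ _ c1 c2 _ It tb)).
have tI : `[0, t] `<=` I by move=> s; rewrite /= in_itv/= => /(I_down It).
have int_le : (int0 (fun s => `|u1 s - u2 s|)%R t <= (c / beta * expR (beta * t))%:E)%E.
  apply: int0_le_expR => //; last 2 first.
  - exact: I_ge0.
  - by move=> s st; apply: h; [exact: I_down st|case/andP: st => _ /le_trans; apply].
  exact: within_continuous_normB (continuous_subspaceW tI c1) (continuous_subspaceW tI c2).
have -> : ((q + L / beta) * c * expR (beta * t))%:E =
   ((q * (c * expR (beta * t)))%:E + L%:E * (c / beta * expR (beta * t))%:E)%E.
  by rewrite -EFinM -EFinD; congr (_%:E); ring.
apply: leeD; first by rewrite lee_fin ler_wpM2l// h.
by apply: lee_wpmul2l => //; rewrite lee_fin.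
Qed.

(** With horizon [t], applying the contraction estimate n times to the two fixed points bounds their
    distance by a multiple of r^n. *)
Lemma fixed_point_unique u v :
  {within I, continuous u} -> {within I, continuous v} ->
  (forall t, I t -> Lam u t = u t) -> (forall t, I t -> Lam v t = v t) ->
  forall t, I t -> v t = u t.
Proof.
move=> u_cont v_cont uE vE t It.
have [r [beta [r01 b0 hr]]] := bielecki_contraction t.
have [c c0 hc] := within_continuous_bounded t v_cont u_cont.
have /andP[r0 r1] := r01.
have h n s : I s -> s <= t -> `|v s - u s| <= r ^+ n * c * expR (beta * s).
  elim: n s => [|n IH] s Is st.
    rewrite expr0 mul1r; apply: (le_trans (hc s Is st)); rewrite ler_peMr// -expR0 ler_expR.
    by rewrite mulr_ge0 ?(ltW b0)// I_ge0.
  rewrite exprS -(mulrA r) -(uE s Is) -(vE s Is).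
  by apply: (hr v u) => //; rewrite mulr_ge0// exprn_ge0.
apply/eqP; rewrite -subr_eq0 -normr_le0.
by apply: (geometric_le0 (r := r) (D := c * expR (beta * t))) => // n; rewrite mulrA h.
Qed.

Let U n : R -> X := iter n Lam (fun=> 0).

Let U_cont n : {within I, continuous (U n)}.
Proof.
elim: n => [|n IH]; last exact: Lam_cont.
by apply: continuous_subspaceT => ?; exact: cvg_cst.
Qed.

(* The same sequence of iterates serves every horizon [b]; only the constants change. *)
Let U_cauchy (b : R) : exists r beta M : R, [/\ 0 <= r < 1, 0 < beta, 0 <= M,
  bielecki_contracting b r beta &
  forall n k t, I t -> t <= b ->
    `|U (n + k)%N t - U n t| <= r ^+ n * M * expR (beta * t)].
Proof.
have [r [beta [r01 b0 hr]]] := bielecki_contraction b.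
have [c c0 hc] := within_continuous_bounded b (@U_cont 1%N) (@U_cont 0%N).
have /andP[r0 r1] := r01; have r1' : 0 < 1 - r by rewrite subr_gt0.
(* This [M] solves r M + c = M, which closes the induction in [hM]. *)
pose M := c / (1 - r); have M0 : 0 <= M by rewrite divr_ge0// ltW.
have hM k t : I t -> t <= b -> `|U k t - U 0%N t| <= M * expR (beta * t).
  elim: k t => [t|k IH t It tb]; first by rewrite subrr normr0 mulr_ge0 ?expR_ge0.
  have -> : U k.+1 t - U 0%N t = (U k.+1 t - U 1%N t) + (U 1%N t - U 0%N t).
    by rewrite addrA subrK.
  apply: (le_trans (ler_normD _ _)).
  have h1 := hr _ _ _ (@U_cont k) (@U_cont 0%N) M0 IH t It tb.
  have h2 : `|U 1%N t - U 0%N t| <= c * expR (beta * t).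
    apply: (le_trans (hc t It tb)); rewrite ler_peMr// -expR0 ler_expR.
    by rewrite mulr_ge0 ?(ltW b0)// I_ge0.
  apply: (le_trans (lerD h1 h2)); rewrite -mulrDl ler_wpM2r ?expR_ge0//.
  by rewrite /M le_eqVlt; apply/orP; left; apply/eqP; field; rewrite gt_eqF.
exists r, beta, M; split=> //.
elim=> [|n IH] k t It tb; first by rewrite expr0 mul1r; exact: hM.
rewrite exprS -(mulrA r); apply: (hr (U (n + k)%N) (U n)) => //.
  by rewrite mulr_ge0// exprn_ge0.
by move=> s Is sb; exact: IH.
Qed.

Theorem history_dependent_fixed_point :
  exists2 u, {within I, continuous u} /\ (forall t, I t -> Lam u t = u t) &
    forall v, {within I, continuous v} -> (forall t, I t -> Lam v t = v t) ->
    forall t, I t -> v t = u t.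
Proof.
(* Off [I] the iterates need not converge; the limit is only used on [I]. *)
pose u t := lim (U n t @[n --> \oo]).
have U_cvg t : I t -> U n t @[n --> \oo] --> u t.
  move=> It; have [r [beta [M [r01 b0 M0 _ hU]]]] := U_cauchy t.
  suff : cvg (U n t @[n --> \oo]) by [].
  apply/cauchy_cvgP/cauchy_exP => e e0.
  have [N hN] := geometric_lt (M * expR (beta * t)) r01 e0.
  exists (U N t), N => // n /= Nn; rewrite -ball_normE /= distrC.
  by apply: le_lt_trans hN; rewrite -(subnKC Nn) mulrA hU.
(* Letting k tend to infinity in [U_cauchy] gives convergence uniform on each bounded part of
   [I]. *)
have U_lim b : exists r beta M : R, [/\ 0 <= r < 1, 0 < beta, 0 <= M,
    bielecki_contracting b r beta &
    forall n t, I t -> t <= b -> `|u t - U n t| <= r ^+ n * M * expR (beta * t)].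
  have [r [beta [M [r01 b0 M0 hr hU]]]] := U_cauchy b.
  exists r, beta, M; split=> // n t It tb.
  apply: (@cvgr_to_le _ \oo _ _ (fun k => `|U (n + k)%N t - U n t|)).
    apply: cvg_norm; apply: cvgB; last exact: cvg_cst.
    have := U_cvg t It; rewrite -(cvg_shiftn n); apply: cvg_trans; apply: near_eq_cvg.
    by apply: nearW => k /=; rewrite addnC.
  by apply: nearW => k; exact: hU.
have u_cont : {within I, continuous u}.
  apply/subspace_continuousP => x Ix; apply/cvgrPdist_lt => e e0.
  (* The horizon x + 1 leaves room for a neighbourhood of [x] in the e / 3 argument. *)
  have [r [beta [M [r01 b0 M0 _ hU]]]] := U_lim (x + 1).
  have e3 : 0 < e / 3 by rewrite divr_gt0// ltr0n.
  have [n hn] := geometric_lt (M * expR (beta * (x + 1))) r01 e3.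
  have hn' s : I s -> s <= x + 1 -> `|u s - U n s| < e / 3.
    move=> Is sx; apply: le_lt_trans (hU n s Is sx) _; apply: le_lt_trans hn.
    rewrite -mulrA ler_wpM2l ?exprn_ge0//; first by case/andP: r01.
    by rewrite ler_wpM2l// ler_expR ler_pM2l.
  have /subspace_continuousP/(_ x Ix)/cvgrPdist_lt/(_ _ e3) := @U_cont n.
  move=> hUn; near=> s.
  have Is : I s by near: s; exact: withinT.
  have sx : s <= x + 1.
    by apply: ltW; near: s; apply: cvg_within; apply: lt_nbhsl; rewrite ltrDl.
  have h1 := hn' x Ix (ltW (ltr_pwDr ltr01 (lexx x))).
  have h2 := hn' s Is sx; rewrite distrC in h2.
  have h3 : `|U n x - U n s| < e / 3 by near: s.
  rewrite (_ : u x - u s = (u x - U n x) + (U n x - U n s) + (U n s - u s)).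
    apply: (le_lt_trans (ler_normD _ _)).
    have := ler_normD (u x - U n x) (U n x - U n s); lra.
  by rewrite !addrA !subrK.
have uE t : I t -> Lam u t = u t.
  move=> It; have [r [beta [M [r01 b0 M0 hr hU]]]] := U_lim t.
  have /andP[r0 r1] := r01.
  apply/eqP; rewrite -subr_eq0 -normr_le0.
  (* The distances of [Lam u t] and of [u t] to the iterate n + 1 are both at most r^n M exp(beta
     t), hence the factor 2. *)
  apply: (geometric_le0 (r := r) (D := 2 * (M * expR (beta * t)))) => // n.
  have h1 : `|Lam u t - U n.+1 t| <= r * (r ^+ n * M) * expR (beta * t).
    by apply: (hr u (U n)) => //; [rewrite mulr_ge0 ?exprn_ge0|exact: hU].
  have h2 := hU n.+1 t It (lexx t); rewrite distrC in h2.
  have h3 := ler_normD (Lam u t - U n.+1 t) (U n.+1 t - u t).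
  rewrite addrA subrK exprS in h2 h3.
  have : r * (r ^+ n * (M * expR (beta * t))) <= r ^+ n * (M * expR (beta * t)).
    by rewrite ler_piMl ?(ltW r1)// !mulr_ge0 ?exprn_ge0 ?expR_ge0.
  lra.
exists u => // v v_cont vE; exact: fixed_point_unique.
Unshelve. all: by end_near.
Qed.

End HistoryDependent.

Lemma within_continuous_lipschitz2 (R : realType) (X Y Z : normedModType R)
    (s : Y -> X -> Z) (a c : R) (D : set R) (y : R -> Y) (x : R -> X) :
  0 <= a -> 0 <= c ->
  (forall y1 y2 x1 x2, `|s y1 x1 - s y2 x2| <= a * `|y1 - y2| + c * `|x1 - x2|) ->
  {within D, continuous y} -> {within D, continuous x} ->
  {within D, continuous (fun t => s (y t) (x t))}.
Proof.
move=> a0 c0 hs /subspace_continuousP cy /subspace_continuousP cx.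
apply/subspace_continuousP => t Dt; apply/cvgrPdist_lt => e e0.
(* Both arguments share this tolerance, as (a + c) e / (a + c + 1) < e; the 1 covers a = c = 0. *)
have d0 : 0 < e / (a + c + 1) by rewrite divr_gt0// ltr_wpDl// addr_ge0.
have /cvgrPdist_lt/(_ _ d0) hy := cy t Dt.
have /cvgrPdist_lt/(_ _ d0) hx := cx t Dt.
near=> r; apply: (le_lt_trans (hs _ _ _ _)).
have /ltW h1 : `|y t - y r| < e / (a + c + 1) by near: r.
have /ltW h2 : `|x t - x r| < e / (a + c + 1) by near: r.
apply: (le_lt_trans (lerD (ler_wpM2l a0 h1) (ler_wpM2l c0 h2))).
rewrite -mulrDl mulrCA -[ltRHS]mulr1 ltr_pM2l// ltr_pdivrMr ?mul1r ?ltrDl//.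
by rewrite ltr_wpDl// addr_ge0.
Unshelve. all: by end_near.
Qed.

(** Inserts the bounds on both operators into the stability estimate. An infinite integral makes the
    right side infinite, since its coefficient is positive. *)
Lemma lee_history_combine (R : realType) (m a dR dS d lR LR lS LS D : R) (I : \bar R) :
  0 < m -> 0 <= a -> 0 < LR -> 0 < LS -> (0 <= I)%E ->
  m * D <= dS + a * dR ->
  (dR%:E <= (lR * d)%:E + LR%:E * I)%E -> (dS%:E <= (lS * d)%:E + LS%:E * I)%E ->
  (D%:E <= ((a * lR + lS) / m * d)%:E + ((a * LR + LS) / m)%:E * I)%E.
Proof.
move=> m0 a0 LR0 LS0; case: I => [I| |//] I0 hD hR hS; last first.
  by rewrite gt0_muley ?addey ?leey// lte_fin divr_gt0// ltr_wpDl// mulr_ge0// ltW.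
rewrite -!EFinM -!EFinD !lee_fin in hR hS *.
have -> : (a * lR + lS) / m * d + (a * LR + LS) / m * I =
  (a * (lR * d + LR * I) + (lS * d + LS * I)) / m by field; rewrite gt_eqF.
rewrite ler_pdivlMr// mulrC; apply: (le_trans hD).
by rewrite addrC lerD// ler_wpM2l.
Qed.

(** * Solving the inclusion *)

Unset Implicit Arguments.

(** Functions on [I] are total functions continuous within [I]. Uniqueness ranges over continuous
    [v] and holds pointwise on [I], in line with the operators acting on C(I;X). *)
Theorem theorem3p1 (R : realType) (X Y : completeNormedModType R)
  (ipX : inner_product X) (ipY : inner_product Y)
  (I : set R) (K : set X) (A : X -> X)
  (Rop : (R -> X) -> R -> Y) (Sop : (R -> X) -> R -> X)
  (j : Y -> X -> R) (f : R -> X) (mA LA alphaj : R)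
  (lR LR lS LS : set R -> R) :
  (* I = [0,T] with T > 0, or I = R_+ *)
  ((exists T : R, 0 < T /\ I = `[0, T]%classic) \/ I = `[0, +oo[%classic) ->
  (* (K) *)
  closed_convex_cone K ->
  (* (A) *)
  0 < mA -> 0 < LA ->
  (forall u v, mA * `|u - v| ^+ 2 <= ipX (A u - A v) (u - v)) ->
  (forall u v, `|A u - A v| <= LA * `|u - v|) ->
  (* (R) *)
  (forall u, {within I, continuous u} -> {within I, continuous (Rop u)}) ->
  (forall J : set R, compact J -> J `<=` I ->
     [/\ 0 < lR J, 0 < LR J &
       forall u1 u2, {within I, continuous u1} -> {within I, continuous u2} ->
       forall t, J t ->
         ((`|Rop u1 t - Rop u2 t|%R)%:E <=
          (lR J * `|u1 t - u2 t|)%R%:E + (LR J)%:E * @int0 R (fun s : R => `|u1 s - u2 s|%R) t)%E]) ->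
  (* (S) *)
  (forall u, {within I, continuous u} -> {within I, continuous (Sop u)}) ->
  (forall J : set R, compact J -> J `<=` I ->
     [/\ 0 < lS J, 0 < LS J &
       forall u1 u2, {within I, continuous u1} -> {within I, continuous u2} ->
       forall t, J t ->
         ((`|Sop u1 t - Sop u2 t|%R)%:E <=
          (lS J * `|u1 t - u2 t|)%R%:E + (LS J)%:E * @int0 R (fun s : R => `|u1 s - u2 s|%R) t)%E]) ->
  (* (j)(a) *)
  (forall eta : Y,
     [/\ (forall (a : R) v1 v2, 0 <= a <= 1 -> K v1 -> K v2 ->
            j eta (a *: v1 + (1 - a) *: v2) <= a * j eta v1 + (1 - a) * j eta v2),
         (forall (a : R) v, 0 < a -> K v -> j eta (a *: v) = a * j eta v) &
         (exists Lj : R, forall v1 v2, K v1 -> K v2 ->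
            `|j eta v1 - j eta v2| <= Lj * `|v1 - v2|)]) ->
  (* (j)(b) *)
  0 <= alphaj ->
  (forall (eta1 eta2 : Y) (v1 v2 : X), K v1 -> K v2 ->
     j eta1 v2 - j eta1 v1 + j eta2 v1 - j eta2 v2
       <= alphaj * `|eta1 - eta2| * `|v1 - v2|) ->
  (* (f) *)
  {within I, continuous f} ->
  (* smallness condition *)
  (forall J : set R, compact J -> J `<=` I -> (alphaj + 1) * (lR J + lS J) < mA) ->
  exists u : R -> X,
    [/\ {within I, continuous u},
        (forall t, I t -> K (u t)),
        (forall t, I t ->
           normal_cone ipX (Cset_t ipX K j f (Rop u t) t) (A (u t) + Sop u t) (- u t))
      & (forall v : R -> X, {within I, continuous v} ->
           (forall t, I t ->
              normal_cone ipX (Cset_t ipX K j f (Rop v t) t) (A (v t) + Sop v t) (- v t)) ->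
           forall t, I t -> v t = u t)].
Proof.
move=> hI Kccc mA0 LA0 monoA lipA Rcont Rhist Scont Shist hj aj0 hjb fcont small.
have [K0 Kclosed Kconvex Kcone] := Kccc.
have [Iclosed Ige0 Idown] : [/\ closed I, (forall t, I t -> 0 <= t) &
    forall s t, I t -> 0 <= s <= t -> I s].
  case: hI => [[T [_ ->]]| ->]; split.
  - exact: interval_closed.
  - by move=> t /=; rewrite in_itv/= => /andP[].
  - move=> s t /=; rewrite !in_itv/= => /andP[_ tT] /andP[-> st].
    exact: le_trans tT.
  - exact: interval_closed.
  - by move=> t /=; rewrite in_itv/= andbT.
  - by move=> s t /=; rewrite !in_itv/= !andbT => _ /andP[].
(* Choosing over pairs gives a single solution map for all frozen data. *)
have /choice[sol' hsol'] : forall p : Y * X, exists u, vi_solution ipX K (j p.1) A p.2 u.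
  move=> [eta g]; have [cvx _ lip] := hj eta.
  exact: (vi_exists K0 Kclosed Kconvex g cvx lip mA0 LA0 monoA lipA).
pose sol eta g := sol' (eta, g).
have hsol eta g : vi_solution ipX K (j eta) A g (sol eta g) by exact: (hsol' (eta, g)).
have sol_stab eta1 eta2 g1 g2 u1 u2 : vi_solution ipX K (j eta1) A g1 u1 ->
    vi_solution ipX K (j eta2) A g2 u2 ->
    mA * `|u1 - u2| <= `|g1 - g2| + alphaj * `|eta1 - eta2|.
  move=> h1 h2; apply: (vi_stability monoA h1 h2); last by rewrite mulr_ge0.
  by apply: hjb; [case: h1|case: h2].
have sol_unique eta g u : vi_solution ipX K (j eta) A g u -> sol eta g = u.
  move=> hu; have := sol_stab _ _ _ _ _ _ (hsol eta g) hu.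
  rewrite !subrr !normr0 mulr0 addr0 pmulr_rle0// normr_le0 subr_eq0.
  by move/eqP.
pose Lam (u : R -> X) t := sol (Rop u t) (f t - Sop u t).
have Lam_fixP u : (forall t, I t -> normal_cone ipX (Cset_t ipX K j f (Rop u t) t)
      (A (u t) + Sop u t) (- u t)) <-> (forall t, I t -> Lam u t = u t).
  split=> h t It; have [cvx hom lip] := hj (Rop u t).
    by apply: sol_unique; apply/(normal_cone_viP _ Kccc cvx hom lip); exact: h.
  apply/(normal_cone_viP _ Kccc cvx hom lip).
  by rewrite -[X in vi_solution _ _ _ _ _ X](h t It); exact: hsol.
have Lam_cont u : {within I, continuous u} -> {within I, continuous (Lam u)}.
  move=> cu.
  apply: (@within_continuous_lipschitz2 R X Y X sol (alphaj / mA) mA^-1 I (Rop u)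
            (fun t => f t - Sop u t)) => //.
  - by rewrite divr_ge0// ltW.
  - by rewrite invr_ge0 ltW.
  - move=> eta1 eta2 g1 g2; have := sol_stab _ _ _ _ _ _ (hsol eta1 g1) (hsol eta2 g2).
    rewrite mulrC -ler_pdivlMr// => /le_trans; apply.
    by rewrite mulrDl addrC mulrAC (mulrC mA^-1).
  - exact: Rcont.
  - move: (fcont) (Scont u cu) => /subspace_continuousP cf /subspace_continuousP cS.
    by apply/subspace_continuousP => t It; apply: cvgB; [exact: cf|exact: cS].
have Lam_hist (b : R) : exists q L : R, [/\ 0 <= q < 1, 0 <= L &
    forall u1 u2, {within I, continuous u1} -> {within I, continuous u2} ->
    forall t, I t -> t <= b ->
    (`|Lam u1 t - Lam u2 t|%:E <= (q * `|u1 t - u2 t|)%:E +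
       L%:E * int0 (fun s => `|u1 s - u2 s|)%R t)%E].
  pose J := I `&` `[0, b].
  have cJ : compact J.
    by rewrite /J setIC; apply: compact_closedI => //; exact: segment_compact.
  have JI : J `<=` I by move=> ? [].
  have [lR0 LR0 hR] := Rhist J cJ JI; have [lS0 LS0 hS] := Shist J cJ JI.
  exists ((alphaj * lR J + lS J) / mA), ((alphaj * LR J + LS J) / mA); split.
  (* The smallness condition suffices because alphaj lR + lS <= (alphaj + 1) (lR + lS). *)
  - apply/andP; split; last first.
      rewrite ltr_pdivrMr// mul1r; apply: le_lt_trans (small J cJ JI).
      rewrite mulrDr !mulrDl !mul1r; have := mulr_ge0 aj0 (ltW lS0); lra.
    exact: divr_ge0 (addr_ge0 (mulr_ge0 aj0 (ltW lR0)) (ltW lS0)) (ltW mA0).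
  - exact: divr_ge0 (addr_ge0 (mulr_ge0 aj0 (ltW LR0)) (ltW LS0)) (ltW mA0).
  move=> u1 u2 c1 c2 t It tb.
  have Jt : J t by split=> //=; rewrite in_itv/= tb Ige0.
  apply: (lee_history_combine mA0 aj0 LR0 LS0 _ _ (hR _ _ c1 c2 t Jt) (hS _ _ c1 c2 t Jt)).
    by apply: integral_ge0 => s _; rewrite lee_fin.
  apply: (le_trans (sol_stab _ _ _ _ _ _ (hsol _ _) (hsol _ _))).
  (* The term [f t] cancels, so the data differ only through [Sop]. *)
  rewrite lerD2r opprB addrA addrAC (addrC (f t)) addrK.
  by rewrite addrC distrC.
have [u [u_cont uE] u_uniq] :=
  history_dependent_fixed_point Iclosed Ige0 Idown Lam_cont Lam_hist.
exists u; split=> //.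
- by move=> t It; rewrite -(uE t It); have [] := hsol (Rop u t) (f t - Sop u t).
- exact/Lam_fixP.
- by move=> v v_cont /Lam_fixP vE; exact: u_uniq.
Qed.
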